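(* Let $m\ge1$. The graded vector space $\mathfrak D^m$, equipped with the products $*_0,\dots,*_m$ defined recursively on trees, is the free $\mathrm{Dyck}^m$ algebra over one element $\#$ (the generator $\#$ corresponding to the tree $\vert$).
   Context: $\mathbb K$ is a field. A $\mathrm{Dyck}^m$ algebra is a $\mathbb K$-vector space $D$ with bilinear operations $*_0,\dots,*_m$ such that for all $x,y,z\in D$: (1) $x*_i(y*_jz)=(x*_iy)*_jz$ for $0\le i<j\le m$; (2) $\sum_{j=0}^i x*_i(y*_jz)=\sum_{k=i}^m (x*_ky)*_iz$ for $0\le i\le m$. $\mathcal Y_{n-1}^m$ is the set of planar binary rooted trees with $n$ leaves whose internal vertices are colored by elements of $\{0,\dots,m\}$; $\vert$ is the tree with one leaf and no internal vertex. $t\vee_iw$ is the tree obtained by joining the roots of $t$ (left) and $w$ (right) to a new root colored $i$. Every tree with at least one internal vertex is uniquely $t=t^l\vee_it^r$. For an internal vertex $v$, $t_v$ is the subtree with root $v$. $\mathcal B_1^m=\{\vert\}$ and, for $n\ge2$, $\mathcal B_n^m\subseteq\mathcal Y_{n-1}^m$ is the set of trees $t$ such that for every internal vertex $v$, writing $t_v=t_v^l\vee_it_v^r$, either $t_v^l=\vert$ or the root of $t_v^l$ has color $j>i$. $\mathfrak D^m$ is the vector space with basis $\bigcup_{n\ge1}\mathcal B_n^m$, graded by $n$. Products: for $t\in\mathcal B_n^m$, $w\in\mathcal B_r^m$ and $0\le i\le m$, $t*_iw$ is defined by recursion on $n+r$ (extended bilinearly, with $\vee_i$ also extended bilinearly):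 - if $n=1$ (i.e. $t=\vert$), or $t=t^l\vee_jt^r$ with $i<j$, then $t*_iw:=t\vee_iw$; - if $t=t^l\vee_jt^r$ with $j<i$, then $t*_iw:=t^l\vee_j(t^r*_iw)$; - if $t=t^l\vee_it^r$, then $t*_iw:=\sum_{k=0}^i t^l\vee_i(t^r*_kw)-\sum_{k=i+1}^m(t^l*_kt^r)\vee_iw$. These expressions lie in $\mathfrak D^m$. *)

(* Defs.v *)
From HB Require Import structures.
From mathcomp Require Import all_boot all_order all_algebra.
From mathcomp Require Import finmap.
From mathcomp.multinomials Require Import monalg.

Set Implicit Arguments.
Unset Strict Implicit.
Unset Printing Implicit Defensive.

Import GRing.Theory.
Local Open Scope ring_scope.

Record Dyck_axioms (K : fieldType) (m : nat) (A : lmodType K)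
    (op : 'I_m.+1 -> A -> A -> A) : Prop := {
  Dyck_bilinear : forall i, bilinear_for *:%R *:%R (op i);
  Dyck_lt : forall (i j : 'I_m.+1) x y z, (i < j)%N ->
    op i x (op j y z) = op j (op i x y) z;
  Dyck_sum : forall (i : 'I_m.+1) x y z,
    \sum_(j < m.+1 | (j <= i)%N) op i x (op j y z)
      = \sum_(k < m.+1 | (i <= k)%N) op i (op k x y) z
}.

Definition Dyck_morphism (K : fieldType) (m : nat) (A B : lmodType K)
    (opA : 'I_m.+1 -> A -> A -> A) (opB : 'I_m.+1 -> B -> B -> B)
    (f : {linear A -> B}) : Prop :=
  forall i x y, f (opA i x y) = opB i (f x) (f y).

Definition free_Dyck_on_one (K : fieldType) (m : nat) (A : lmodType K)
    (op : 'I_m.+1 -> A -> A -> A) (a : A) : Prop :=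
  Dyck_axioms op /\
  forall (B : lmodType K) (opB : 'I_m.+1 -> B -> B -> B), Dyck_axioms opB ->
  forall b : B, exists f : {linear A -> B},
    [/\ Dyck_morphism op opB f, f a = b
      & forall g : {linear A -> B}, Dyck_morphism op opB g -> g a = b ->
        g =1 f].

Inductive ctree (m : nat) : Type :=
  | Leaf
  | Node of 'I_m.+1 & ctree m & ctree m.
Arguments Leaf {m}.

Section CtreeChoice.
Variable m : nat.

Fixpoint ctree_encode (t : ctree m) : GenTree.tree 'I_m.+1 :=
  match t with
  | Leaf => GenTree.Node 0 [::]
  | Node i l r =>
      GenTree.Node 1 [:: GenTree.Leaf i; ctree_encode l; ctree_encode r]
  end.

Fixpoint ctree_decode (u : GenTree.tree 'I_m.+1) : option (ctree m) :=
  match u with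
  | GenTree.Node 0 [::] => Some Leaf
  | GenTree.Node 1 [:: GenTree.Leaf i; l; r] =>
      match ctree_decode l, ctree_decode r with
      | Some l', Some r' => Some (Node i l' r')
      | _, _ => None
      end
  | _ => None
  end.

Lemma ctree_encodeK : pcancel ctree_encode ctree_decode.
Proof. by elim=> [|i l IHl r IHr] //=; rewrite IHl IHr. Qed.

HB.instance Definition _ := Countable.copy (ctree m) (pcan_type ctree_encodeK).

End CtreeChoice.

Fixpoint leaves (m : nat) (t : ctree m) : nat :=
  if t is Node _ l r then (leaves l + leaves r)%N else 1%N.

Definition root_gt (m : nat) (p : nat) (t : ctree m) : bool :=
  if t is Node j _ _ then (p < j)%N else true.

(* [inB t]: t belongs to the union over n of the sets B_n^m. *)
Fixpoint inB (m : nat) (t : ctree m) : bool :=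
  if t is Node i l r then [&& root_gt i l, inB l & inB r] else true.

Section Products.
Variables (K : fieldType) (m : nat).

Definition bilext (T : choiceType) (f : T -> T -> {malg K[T]})
    (x y : {malg K[T]}) : {malg K[T]} :=
  \sum_(t <- msupp x) \sum_(w <- msupp y) (x@_t * y@_w) *: f t w.

Definition graft (i : 'I_m.+1) : {malg K[ctree m]} -> {malg K[ctree m]} ->
    {malg K[ctree m]} :=
  bilext (fun t w => << Node i t w >>).

(* The recursion on the total number of leaves is structural in t. *)
Fixpoint tree_mul (t : ctree m) (i : 'I_m.+1) (w : ctree m) :
    {malg K[ctree m]} :=
  match t with
  | Leaf => << Node i t w >>
  | Node j l r =>
      if (i < j)%N then << Node i t w >>
      else if (j < i)%N then graft j << l >> (tree_mul r i w)
      else \sum_(k < m.+1 | (k <= i)%N) graft i << l >> (tree_mul r k w)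
           - \sum_(k < m.+1 | (i < k)%N) graft i (tree_mul l k r) << w >>
  end.

Definition supp_in (P : pred (ctree m)) : pred {malg K[ctree m]} :=
  fun x => all P (msupp x).

Lemma supp_inP (P : pred (ctree m)) x :
  reflect (forall t, x@_t != 0 -> P t) (x \in supp_in P).
Proof.
by apply: (iffP allP) => H t; [rewrite mcoeff_neq0 | rewrite -mcoeff_neq0];
  apply: H.
Qed.

Lemma supp_in_submod (P : pred (ctree m)) : submod_closed (supp_in P).
Proof.
split=> [|a x y /supp_inP Px /supp_inP Py]; apply/supp_inP => t.
  by rewrite mcoeff0 eqxx.
rewrite mcoeffD mcoeffZ; apply: contraR => nPt.
have -> : x@_t = 0 by apply/eqP; apply: contraNT nPt => /Px.
have -> : y@_t = 0 by apply/eqP; apply: contraNT nPt => /Py.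
by rewrite mulr0 addr0.
Qed.

HB.instance Definition _ (P : pred (ctree m)) :=
  GRing.isSubmodClosed.Build K {malg K[ctree m]} (supp_in P)
    (supp_in_submod P).

Lemma supp_inU (P : pred (ctree m)) t : P t -> << t >> \in supp_in P.
Proof.
move=> Pt; apply/supp_inP => u; rewrite mcoeffU.
by case: (eqVneq t u) => [<-//|_]; rewrite mulr0n eqxx.
Qed.

Lemma bilext_supp_in (P Q S : pred (ctree m)) f x y :
  x \in supp_in P -> y \in supp_in Q ->
  (forall t w, P t -> Q w -> f t w \in supp_in S) ->
  bilext f x y \in supp_in S.
Proof.
move=> /allP Px /allP Qy PQS; rewrite /bilext.
rewrite big_seq; apply: rpred_sum => t /Px Pt.
rewrite big_seq; apply: rpred_sum => w /Qy Qw.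
by apply: rpredZ; apply: PQS.
Qed.

Lemma tree_mul_root_gt p t (i : 'I_m.+1) w :
  root_gt p t -> (p < i)%N -> tree_mul t i w \in supp_in (root_gt p).
Proof.
case: t => [|j l r] /= pj pi; first exact: supp_inU.
have graft_in x y : graft j x y \in supp_in (root_gt p).
  apply: (@bilext_supp_in predT predT); [exact/allP | exact/allP |].
  by move=> t u _ _; apply: supp_inU.
case: ltngtP => [ij | ji | /val_inj ij]; first exact: supp_inU.
  exact: graft_in.
by rewrite ij; apply: rpredB; apply: rpred_sum => k _; apply: graft_in.
Qed.

Lemma tree_mul_inB t (i : 'I_m.+1) w :
  inB t -> inB w -> tree_mul t i w \in supp_in (@inB m).
Proof.
elim: t i w => [|j l IHl r IHr] i w /=; first by move=> _ Bw; apply: supp_inU.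
case/and3P=> jl Bl Br Bw.
have graftr k : graft j << l >> (tree_mul r k w) \in supp_in (@inB m).
  apply: (@bilext_supp_in (pred1 l) (@inB m)); last first.
  - by move=> _ u /eqP -> Bu; apply: supp_inU; rewrite /= jl Bl.
  - exact: IHr.
  - by apply: supp_inU => /=.
case: ltngtP => [ij | ji | /val_inj ij]; last 1 first.
- rewrite ij; apply: rpredB; apply: rpred_sum => k jk; first exact: graftr.
  apply: (@bilext_supp_in (predI (root_gt j) (@inB m)) (pred1 w)).
  + apply/allP => u u_in /=; apply/andP; split.
    * by have /allP := tree_mul_root_gt r jl jk; apply.
    * by have /allP := IHl k r Bl Br; apply.
  + by apply: supp_inU => /=.
  + by move=> u _ /andP[ju Bu] /eqP ->; apply: supp_inU; rewrite /= ju Bu.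
- by apply: supp_inU; rewrite /= ij jl Bl Br.
- exact: graftr.
Qed.

(* D^m, as the span of the trees satisfying [inB] in the free module on all
   coloured trees. *)
Record Dm : predArgType :=
  MkDm { Dm_val : {malg K[ctree m]}; _ : Dm_val \in supp_in (@inB m) }.

HB.instance Definition _ := [isSub for Dm_val].
HB.instance Definition _ := [Choice of Dm by <:].
HB.instance Definition _ := [SubChoice_isSubLmodule of Dm by <:].

Lemma Dm_mul_subproof (i : 'I_m.+1) (x y : Dm) :
  bilext (fun t w => tree_mul t i w) (val x) (val y) \in supp_in (@inB m).
Proof.
apply: bilext_supp_in (valP x) (valP y) _ => t w.
exact: tree_mul_inB.
Qed.

Definition Dm_mul (i : 'I_m.+1) (x y : Dm) : Dm :=
  MkDm (Dm_mul_subproof i x y).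

Lemma Dm_leaf_subproof : << Leaf >> \in supp_in (@inB m).
Proof. exact: supp_inU. Qed.

Definition Dm_leaf : Dm := MkDm Dm_leaf_subproof.

(* The homogeneous component of degree n: the span of B_n^m. *)
Definition Dm_homog (n : nat) : pred Dm :=
  fun x => val x \in supp_in (fun t => leaves t == n).

End Products.

(* Main.v *)
From HB Require Import structures.
Require Import Defs.
From mathcomp Require Import all_boot all_order all_algebra.
From mathcomp Require Import finmap.
From mathcomp.multinomials Require Import monalg.

Set Implicit Arguments.
Unset Strict Implicit.
Unset Printing Implicit Defensive.

Import GRing.Theory.
Local Open Scope ring_scope.

(** Freeness has three ingredients.

    The Dyck identities.  They are proved on the span of all coloured trees,
    and the span of the trees satisfying [inB] inherits them as a submodule
    stable under the products.  The recursive rules for a product of trees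
    extend bilinearly to rules for [mul i (graft p x y) z] with arbitrary
    vectors x, y, z ([mul_graft_gt], [mul_graft_lt], [mul_graft_eq]).  This
    makes it possible to fix a tree x, keep y and z arbitrary, and argue by
    structural induction on x.  Let p be the colour of the root of x and i the
    index of the outer product on the left-hand side.  If i < p (or x is the
    leaf) both sides unfold to the same expression.  If p < i every product
    whose left factor involves x descends into the right subtree, where the
    induction hypothesis applies.  If p = i the first
    identity again descends termwise, while the second reduces to two
    equalities between double sums, one in the right subtree over indices at
    most i ([low_square_sum]), the other in the left subtree over indices
    greater than i ([high_square_sum]); each comes from splitting a square of
    indices along its diagonal and using one Dyck identity on each half.

    Existence.  Given an element b of a Dyck algebra B, evaluate a tree by
    putting b at the leaves and the product i at the vertices coloured i.  The
    linear extension is a morphism ([node_morphism_mul]): each clause of the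
    recursion becomes, after evaluation, one of the Dyck identities of B; the
    clause for equal colours is the second identity with its term k = i
    isolated.

    Uniqueness.  The condition [inB] says exactly that the product of the two
    subtrees at a vertex falls under the first clause of the recursion, so that
    a tree with root colour i is the i-th product of its subtrees
    ([Dm_tree_Node]).  Hence the leaf generates. *)

(** * Linear maps on a free module *)

Lemma linear_for_sum (K : fieldType) (U V : lmodType K) (I : finType) (P : pred I)
    (f : I -> U -> V) :
  (forall k, GRing.linear_for *:%R (f k)) ->
  GRing.linear_for *:%R (fun x => \sum_(k | P k) f k x).
Proof.
move=> lin_f a u v /=; rewrite scaler_sumr -big_split.
by apply: eq_bigr => k _; apply: lin_f.
Qed.

Lemma linear_for_sub (K : fieldType) (U V : lmodType K) (f g : U -> V) :
  GRing.linear_for *:%R f -> GRing.linear_for *:%R g ->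
  GRing.linear_for *:%R (fun x => f x - g x).
Proof.
move=> lin_f lin_g a u v /=; rewrite lin_f lin_g scalerBr.
by rewrite opprD addrACA.
Qed.

Section LinearExtension.
Variables (K : fieldType) (T : choiceType).

Definition linext (V : lmodType K) (f : T -> V) (x : {malg K[T]}) : V :=
  \sum_(t <- msupp x) x@_t *: f t.

Lemma linextEw (V : lmodType K) (f : T -> V) (d : {fset T}) x :
  (msupp x `<=` d)%fset -> linext f x = \sum_(t <- d) x@_t *: f t.
Proof.
move=> le_xd; rewrite /linext (big_fset_incl _ le_xd) // => t _.
by rewrite -mcoeff_eq0 => /eqP ->; rewrite scale0r.
Qed.

Lemma linext_is_linear (V : lmodType K) (f : T -> V) :
  GRing.linear_for *:%R (linext f).
Proof.
move=> a x y; pose d := (msupp x `|` msupp y)%fset.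
rewrite (@linextEw _ f d (a *: x + y)); last first.
  apply: fsubset_trans (msuppD_le _ _) _.
  by rewrite fsetSU // msuppZ_le.
rewrite (linextEw f (fsubsetUl _ _ : (msupp x `<=` d)%fset)).
rewrite (linextEw f (fsubsetUr _ _ : (msupp y `<=` d)%fset)).
rewrite scaler_sumr -big_split; apply: eq_bigr => t _ /=.
by rewrite mcoeffD mcoeffZ scalerDl scalerA.
Qed.

HB.instance Definition _ (V : lmodType K) (f : T -> V) :=
  GRing.isLinear.Build K {malg K[T]} V *:%R (linext f) (linext_is_linear f).

Lemma linextU (V : lmodType K) (f : T -> V) t : linext f << t >> = f t.
Proof.
rewrite (linextEw f msuppU_le) big_seq_fset1.
by rewrite mcoeffUU scale1r.
Qed.

Lemma linext_id (x : {malg K[T]}) : linext (fun t => << t >>) x = x.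
Proof.
rewrite [RHS]monalgE; apply: eq_bigr => t _; apply/malgP => u.
by rewrite mcoeffZ !mcoeffU mulrnAr mulr1.
Qed.

Lemma linear_ext (V : lmodType K) (f g : {malg K[T]} -> V) :
  GRing.linear_for *:%R f -> GRing.linear_for *:%R g ->
  (forall t, f << t >> = g << t >>) -> f =1 g.
Proof.
move=> lin_f lin_g fg x.
pose F : {linear {malg K[T]} -> V} :=
  HB.pack f (GRing.isLinear.Build _ _ _ _ f lin_f).
pose G : {linear {malg K[T]} -> V} :=
  HB.pack g (GRing.isLinear.Build _ _ _ _ g lin_g).
suff: F x = G x by [].
rewrite -(linext_id x) /linext !linear_sum.
by apply: eq_bigr => t _; rewrite !linearZ /= fg.
Qed.

Lemma bilextE (f : T -> T -> {malg K[T]}) x y :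
  bilext f x y = linext (fun t => linext (f t) y) x.
Proof.
by apply: eq_bigr => t _; rewrite scaler_sumr; apply: eq_bigr => w _;
  rewrite scalerA.
Qed.

Lemma bilext_is_bilinear (f : T -> T -> {malg K[T]}) :
  bilinear_for *:%R *:%R (bilext f).
Proof.
split=> [y | x] a u v /=; rewrite !bilextE; first exact: linearP.
rewrite /linext scaler_sumr -big_split; apply: eq_bigr => t _ /=.
by rewrite -/(linext (f t) _) linearP scalerDr !scalerA mulrC.
Qed.

Lemma bilextUU (f : T -> T -> {malg K[T]}) t w :
  bilext f << t >> << w >> = f t w.
Proof. by rewrite bilextE !linextU. Qed.

End LinearExtension.

(** * Double sums over a square of indices *)

(** The second triangle is transposed, so that both inner sums share the outer
    index: this is the form in which a Dyck identity applies to each of them. *)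
Lemma sum_square_triangles (V : nmodType) (I : finType) (P : pred I)
    (e : rel I) (F : I -> I -> V) :
  \sum_(h | P h) \sum_(k | P k) F h k
    = \sum_(h | P h) (\sum_(k | P k && e h k) F h k
                      + \sum_(k | P k && ~~ e k h) F k h).
Proof.
rewrite big_split /= [X in _ = _ + X](exchange_big_dep P) /=; last first.
  by move=> h k _ /andP[].
rewrite -big_split; apply: eq_bigr => h Ph /=.
rewrite (bigID (e h)) /=; congr (_ + _).
by apply: eq_bigl => k; rewrite Ph.
Qed.

(** * The product recursion over an abstract module *)

(** The module is kept abstract, with [tree] a spanning family that determines
    linear maps: the arguments below use nothing but bilinearity and the clauses
    of the recursion, and the sums stay free of coefficient computations. *)

Section TreeRecursion.
Variables (K : fieldType) (m : nat) (A : lmodType K).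
Variables (mul graft : 'I_m.+1 -> A -> A -> A) (tree : ctree m -> A).
Implicit Types (i j k h p : 'I_m.+1) (x y z u : A) (t l r w : ctree m).

Hypothesis mul_bilinear : forall i, bilinear_for *:%R *:%R (mul i).
Hypothesis graft_bilinear : forall i, bilinear_for *:%R *:%R (graft i).
Hypothesis tree_linear_ext : forall (V : lmodType K) (f g : A -> V),
  GRing.linear_for *:%R f -> GRing.linear_for *:%R g ->
  (forall t, f (tree t) = g (tree t)) -> f =1 g.
Hypothesis graft_tree : forall i l r,
  graft i (tree l) (tree r) = tree (Node i l r).
Hypothesis mul_tree_root_gt : forall i t w, root_gt i t ->
  mul i (tree t) (tree w) = graft i (tree t) (tree w).
Hypothesis mul_Node_lt : forall i p l r w, (p < i)%N ->
  mul i (tree (Node p l r)) (tree w)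
    = graft p (tree l) (mul i (tree r) (tree w)).
Hypothesis mul_Node_eq : forall i l r w,
  mul i (tree (Node i l r)) (tree w)
    = \sum_(k < m.+1 | (k <= i)%N) graft i (tree l) (mul k (tree r) (tree w))
      - \sum_(k < m.+1 | (i < k)%N)
          graft i (mul k (tree l) (tree r)) (tree w).

HB.instance Definition _ i :=
  bilinear_isBilinear.Build K A A A *:%R *:%R (mul i) (mul_bilinear i).
HB.instance Definition _ i :=
  bilinear_isBilinear.Build K A A A *:%R *:%R (graft i) (graft_bilinear i).

Lemma tree_bilinear_ext (V : lmodType K) (f g : A -> A -> V) :
  bilinear_for *:%R *:%R f -> bilinear_for *:%R *:%R g ->
  (forall t w, f (tree t) (tree w) = g (tree t) (tree w)) -> f =2 g.
Proof.
move=> [lf rf] [lg rg] fg x y.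
apply: (tree_linear_ext (lf y) (lg y)) => t /=.
exact: (tree_linear_ext (rf _) (rg _)).
Qed.

Lemma mul_root_gt i t z : root_gt i t -> mul i (tree t) z = graft i (tree t) z.
Proof.
move=> it; move: z; apply: tree_linear_ext => [||w]; try exact: linearPr.
exact: mul_tree_root_gt.
Qed.

Lemma mul_graft_gt i p x y z : (i < p)%N ->
  mul i (graft p x y) z = graft i (graft p x y) z.
Proof.
move=> ip; move: x y; apply: tree_bilinear_ext => [||l r].
- by split=> [y | x] a u v /=; rewrite ?linearPl ?linearPr ?linearPl.
- by split=> [y | x] a u v /=; rewrite ?linearPl ?linearPr ?linearPl.
by rewrite graft_tree mul_root_gt.
Qed.

Lemma mul_graft_lt i p x y z : (p < i)%N ->
  mul i (graft p x y) z = graft p x (mul i y z).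
Proof.
move=> pi; move: x y; apply: tree_bilinear_ext => [||l r].
- by split=> [y | x] a u v /=; rewrite ?linearPl ?linearPr ?linearPl.
- by split=> [y | x] a u v /=; rewrite ?linearPl ?linearPr.
rewrite graft_tree; move: z; apply: tree_linear_ext => [|a u v|w] /=.
- exact: linearPr.
- by rewrite !linearPr.
exact: mul_Node_lt.
Qed.

Lemma mul_graft_eq i x y z :
  mul i (graft i x y) z
    = \sum_(k < m.+1 | (k <= i)%N) graft i x (mul k y z)
      - \sum_(k < m.+1 | (i < k)%N) graft i (mul k x y) z.
Proof.
move: x y; apply: tree_bilinear_ext => [||l r].
- by split=> [y | x] a u v /=; rewrite ?linearPl ?linearPr ?linearPl.
- split=> [y | x]; apply: linear_for_sub; apply: linear_for_sum => k a u v /=.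
  + exact: linearPl.
  + by rewrite !linearPl.
  + by rewrite linearPl linearPr.
  + by rewrite linearPr linearPl.
rewrite graft_tree; move: z; apply: tree_linear_ext => [||w].
- exact: linearPr.
- apply: linear_for_sub; apply: linear_for_sum => k a u v /=.
    by rewrite !linearPr.
  by rewrite linearPr.
exact: mul_Node_eq.
Qed.

(** Multiplying on the right by an index above i keeps all root colours above i
    or produces the root colour k > i, so that a further product by i stays in
    the first clause. *)
Lemma mul_mul_root_gt i k t y z : root_gt i t -> (i < k)%N ->
  mul i (mul k (tree t) y) z = graft i (mul k (tree t) y) z.
Proof.
case: t => [|p l r] /= ip ik; first by rewrite mul_root_gt // mul_graft_gt.
case: (ltngtP k p) => [kp | pk | /val_inj kp].
- by rewrite mul_root_gt // mul_graft_gt.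
- by rewrite -graft_tree mul_graft_lt // mul_graft_gt.
- rewrite -graft_tree -kp mul_graft_eq !linearBl !linear_sumlz /=.
  by congr (_ - _); apply: eq_bigr => h _; rewrite mul_graft_gt.
Qed.

(** The two Dyck identities are stated at a fixed first argument, which is the
    one the induction runs on; the other two range over all vectors. *)
Definition Dyck_lt_at x : Prop := forall i j y z, (i < j)%N ->
  mul i x (mul j y z) = mul j (mul i x y) z.

Definition Dyck_sum_at x : Prop := forall i y z,
  \sum_(j < m.+1 | (j <= i)%N) mul i x (mul j y z)
    = \sum_(k < m.+1 | (i <= k)%N) mul i (mul k x y) z.

(** For fixed h, the terms with k >= h add up to the right-hand side of the second
    Dyck identity, and those with k < h are reassociated one by one by the
    first; together they fill the square below i. *)
Lemma low_square_sum x i y z : Dyck_lt_at x -> Dyck_sum_at x ->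
  \sum_(h < m.+1 | (h <= i)%N) \sum_(k < m.+1) mul h (mul k x y) z
    = \sum_(h < m.+1 | (h <= i)%N) \sum_(k < m.+1 | (k <= i)%N)
        mul h x (mul k y z).
Proof.
move=> x_lt x_sum.
rewrite (sum_square_triangles _ (fun h k : 'I_m.+1 => (k <= h)%N)).
apply: eq_bigr => h hi; rewrite (bigID (fun k : 'I_m.+1 => (h <= k)%N)) /=.
congr (_ + _).
  rewrite -x_sum; apply: eq_bigl => k.
  by case: (leqP k h) => kh; rewrite ?andbF // (leq_trans kh hi).
apply: eq_big => [k | k]; rewrite -ltnNge; last by move=> kh; rewrite x_lt.
by case: (ltnP k h) => kh; rewrite ?andbF // (leq_trans (ltnW kh) hi).
Qed.

(** The mirror image of [low_square_sum]: here the second Dyck identity is read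
    from left to right on the terms with k <= h. *)
Lemma high_square_sum x i y z : Dyck_lt_at x -> Dyck_sum_at x ->
  \sum_(h < m.+1 | (i < h)%N) \sum_(k < m.+1) mul h x (mul k y z)
    = \sum_(h < m.+1 | (i < h)%N) \sum_(k < m.+1 | (i < k)%N)
        mul h (mul k x y) z.
Proof.
move=> x_lt x_sum.
rewrite (sum_square_triangles _ (fun h k : 'I_m.+1 => (h <= k)%N)).
apply: eq_bigr => h hi; rewrite (bigID (fun k : 'I_m.+1 => (k <= h)%N)) /=.
congr (_ + _).
  rewrite x_sum; apply: eq_bigl => k.
  by case: (leqP h k) => hk; rewrite ?andbF // (leq_trans hi hk).
apply: eq_big => [k | k]; rewrite -ltnNge; last by move=> kh; rewrite x_lt.
by case: (ltnP h k) => hk; rewrite ?andbF // (ltn_trans hi hk).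
Qed.

(** The first sum in the k = i term runs over colours up to i, and the terms with
    k > i descend into the right subtree: together they reach all colours. *)
Lemma sum_mul_graft_ge i x y z :
  \sum_(k < m.+1 | (i <= k)%N) mul k (graft i x y) z
    = graft i x (\sum_(k < m.+1) mul k y z)
      - graft i (\sum_(k < m.+1 | (i < k)%N) mul k x y) z.
Proof.
rewrite (bigD1 i) //= mul_graft_eq linear_sumlz addrAC; congr (_ - _).
rewrite linear_sumr [RHS](bigID (fun k : 'I_m.+1 => (k <= i)%N)) /=.
congr (_ + _); apply: eq_big => [k | k].
  by rewrite -ltnNge ltn_neqAle eq_sym andbC.
by case/andP=> ik ki; rewrite mul_graft_lt // ltn_neqAle eq_sym ki.
Qed.

(** The critical case of equal colours.  After expansion both sides are
    combinations of [graft i x _] and [graft i _ _]; the terms grafted on x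
    agree by [low_square_sum], and the terms [graft i (mul h x (mul k v y)) z] and
    [graft i (mul h (mul k x v) y) z] on the right, with opposite signs, cancel
    by [high_square_sum]. *)
Lemma Dyck_sum_at_graft i x v y z :
    Dyck_lt_at x -> Dyck_sum_at x -> Dyck_lt_at v -> Dyck_sum_at v ->
  \sum_(j < m.+1 | (j <= i)%N) mul i (graft i x v) (mul j y z)
    = \sum_(k < m.+1 | (i <= k)%N) mul i (mul k (graft i x v) y) z.
Proof.
move=> x_lt x_sum v_lt v_sum.
rewrite -(linear_sumlz (mul i)) sum_mul_graft_ge linearBl /= !mul_graft_eq.
set S := \sum_k mul k v y.
set T := \sum_(k < m.+1 | (i < k)%N) mul k x v.
under eq_bigr do rewrite mul_graft_eq.
rewrite sumrB.
(* The terms grafted on x agree, by the identities at v. *)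
have -> : \sum_(j < m.+1 | (j <= i)%N) \sum_(k < m.+1 | (k <= i)%N)
    graft i x (mul k v (mul j y z))
  = \sum_(h < m.+1 | (h <= i)%N) graft i x (mul h S z).
  rewrite exchange_big -linear_sumr.
  under eq_bigr do rewrite -linear_sumr.
  rewrite -linear_sumr -low_square_sum //; congr (graft i x _).
  by apply: eq_bigr => h _; rewrite linear_sumlz.
have -> : \sum_(j < m.+1 | (j <= i)%N) \sum_(k < m.+1 | (i < k)%N)
    graft i (mul k x v) (mul j y z)
  = \sum_(h < m.+1 | (h <= i)%N) graft i T (mul h y z).
  by apply: eq_bigr => h _; rewrite linear_sumlz.
(* The terms grafted on the left of z cancel, by the identities at x. *)
have -> : \sum_(h < m.+1 | (i < h)%N) graft i (mul h x S) z
  = \sum_(h < m.+1 | (i < h)%N) graft i (mul h T y) z.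
  rewrite -!(linear_sumlz (graft i)); congr (graft i _ z).
  under eq_bigr do rewrite linear_sumr.
  rewrite high_square_sum //.
  by apply: eq_bigr => h _; rewrite linear_sumlz.
by rewrite opprB addrA subrK.
Qed.

Lemma Dyck_lt_at_tree t : Dyck_lt_at (tree t).
Proof.
elim: t => [|p l _ r r_lt] i j y z ij.
  by rewrite !mul_root_gt // mul_graft_lt.
case: (ltngtP i p) => [ip | pi | /val_inj ip].
- by rewrite !mul_root_gt // mul_graft_lt.
- by rewrite -graft_tree !mul_graft_lt ?(ltn_trans pi ij) // r_lt.
rewrite -ip -graft_tree !mul_graft_eq linearBl !linear_sumlz /=.
congr (_ - _); apply: eq_bigr => k ki; rewrite mul_graft_lt //.
by rewrite r_lt // (leq_ltn_trans ki ij).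
Qed.

(** The negative sum in the clause for [mul i (graft i _ _)] exactly cancels the
    terms with k > i. *)
Lemma Dyck_sum_at_root_gt i t y z : root_gt i t ->
  \sum_(j < m.+1 | (j <= i)%N) mul i (tree t) (mul j y z)
    = \sum_(k < m.+1 | (i <= k)%N) mul i (mul k (tree t) y) z.
Proof.
move=> it; rewrite [RHS](bigD1 i) //= [in RHS]mul_root_gt // mul_graft_eq.
under [LHS]eq_bigr do rewrite mul_root_gt //.
rewrite -addrA -[LHS]addr0; congr (_ + _).
apply/esym/eqP; rewrite addrC subr_eq0; apply/eqP.
apply: eq_big => [k | k]; first by rewrite ltn_neqAle eq_sym andbC.
by case/andP=> ik ki; rewrite mul_mul_root_gt // ltn_neqAle eq_sym ki.
Qed.

Lemma Dyck_sum_at_tree t : Dyck_sum_at (tree t).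
Proof.
elim: t => [|p l l_sum r r_sum] i y z; first exact: Dyck_sum_at_root_gt.
case: (ltngtP i p) => [ip | pi | /val_inj ip].
- exact: Dyck_sum_at_root_gt.
- rewrite -graft_tree; under eq_bigr do rewrite mul_graft_lt //.
  rewrite -linear_sumr r_sum linear_sumr; apply: eq_bigr => k ik.
  by rewrite !mul_graft_lt // (leq_trans pi ik).
rewrite -ip -graft_tree.
by apply: Dyck_sum_at_graft => //; apply: Dyck_lt_at_tree.
Qed.

Theorem tree_recursion_Dyck_axioms : Dyck_axioms mul.
Proof.
split=> [|i j x y z ij | i x y z]; first exact: mul_bilinear.
- move: x; apply: tree_linear_ext => [a u v | a u v | t] /=.
  + exact: linearPl.
  + by rewrite !linearPl.
  exact: Dyck_lt_at_tree.
- move: x; apply: tree_linear_ext => [||t]; last exact: Dyck_sum_at_tree.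
  + by apply: linear_for_sum => j a u v /=; apply: linearPl.
  + by apply: linear_for_sum => j a u v /=; rewrite !linearPl.
Qed.

(** Such a map turns grafting into the product on all vectors by bilinearity, and
    then every clause of the recursion is mapped to a consequence
    of the Dyck identities of the target. *)
Lemma node_morphism_mul (B : lmodType K) (op : 'I_m.+1 -> B -> B -> B)
    (f : {linear A -> B}) :
  Dyck_axioms op ->
  (forall i l r, f (tree (Node i l r)) = op i (f (tree l)) (f (tree r))) ->
  Dyck_morphism mul op f.
Proof.
move=> op_Dyck f_node.
have op_f_bilinear i : bilinear_for *:%R *:%R (fun x y => op i (f x) (f y)).
  have [op_l op_r] := Dyck_bilinear op_Dyck i.
  by split=> [y | x] a u v /=; rewrite linearP ?op_l ?op_r.
have f_graft i x y : f (graft i x y) = op i (f x) (f y).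
  move: x y; apply: tree_bilinear_ext => [||l r]; [| exact: op_f_bilinear |].
    by split=> [y | x] a u v /=; rewrite ?linearPl ?linearPr linearP.
  by rewrite graft_tree f_node.
move=> i; apply: tree_bilinear_ext => [||t w]; [| exact: op_f_bilinear |].
  by split=> [y | x] a u v /=; rewrite ?linearPl ?linearPr linearP.
elim: t i w => [|p l IHl r IHr] i w; first by rewrite mul_root_gt // f_graft.
case: (ltngtP i p) => [ip | pi | /val_inj ip].
- by rewrite mul_root_gt // f_graft.
- by rewrite mul_Node_lt // f_graft IHr f_node (Dyck_lt op_Dyck).
rewrite -ip mul_Node_eq linearB !(linear_sum f) /=.
under eq_bigr do rewrite f_graft IHr.
under [X in _ - X]eq_bigr do rewrite f_graft IHl.
rewrite (Dyck_sum op_Dyck) (bigD1 i) //= f_node.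
(* The term k = i is the value of the product; the others are subtracted. *)
apply/eqP; rewrite subr_eq; apply/eqP; congr (_ + _).
by apply: eq_bigl => k; rewrite ltn_neqAle eq_sym andbC.
Qed.

End TreeRecursion.

(** * The products on the span of coloured trees *)

Section TreeProducts.
Variables (K : fieldType) (m : nat).
Local Notation A := {malg K[ctree m]}.
Implicit Types (i j k h p : 'I_m.+1) (x y z : A) (t l r w : ctree m).

Definition malg_mul i : A -> A -> A := bilext (fun t w => tree_mul K t i w).

Lemma malg_mulUU i t w : malg_mul i << t >> << w >> = tree_mul K t i w.
Proof. exact: bilextUU. Qed.

Lemma graftUU i l r : graft i << l >> << r >> = << Node i l r >> :> A.
Proof. exact: bilextUU. Qed.

Lemma malg_mul_root_gt i t w : root_gt i t ->
  malg_mul i << t >> << w >> = graft i << t >> << w >>.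
Proof. by case: t => [|j l r] /= ij; rewrite malg_mulUU graftUU //= ij. Qed.

Lemma malg_mul_Node_lt i p l r w : (p < i)%N ->
  malg_mul i << Node p l r >> << w >> = graft p << l >> (malg_mul i << r >> << w >>).
Proof. by move=> pi; rewrite !malg_mulUU /= ltnNge (ltnW pi) /= pi. Qed.

Lemma malg_mul_Node_eq i l r w :
  malg_mul i << Node i l r >> << w >>
    = \sum_(k < m.+1 | (k <= i)%N) graft i << l >> (malg_mul k << r >> << w >>)
      - \sum_(k < m.+1 | (i < k)%N) graft i (malg_mul k << l >> << r >>) << w >>.
Proof.
rewrite malg_mulUU /= ltnn.
by apply: congr2; [|apply: congr1]; apply: eq_bigr => k _; rewrite malg_mulUU.
Qed.

Lemma malg_mul_Dyck_axioms : Dyck_axioms malg_mul.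
Proof.
exact: (tree_recursion_Dyck_axioms
  (fun i => bilext_is_bilinear _) (fun i => bilext_is_bilinear _)
  (@linear_ext K (ctree m)) graftUU
  malg_mul_root_gt malg_mul_Node_lt malg_mul_Node_eq).
Qed.

Lemma node_morphism_tree_mul (B : lmodType K) (op : 'I_m.+1 -> B -> B -> B)
    (f : {linear A -> B}) :
  Dyck_axioms op ->
  (forall i l r, f << Node i l r >> = op i (f << l >>) (f << r >>)) ->
  Dyck_morphism malg_mul op f.
Proof.
exact: (node_morphism_mul
  (fun i => bilext_is_bilinear _) (fun i => bilext_is_bilinear _)
  (@linear_ext K (ctree m)) graftUU
  malg_mul_root_gt malg_mul_Node_lt malg_mul_Node_eq).
Qed.

Lemma val_Dm_mul i (x y : Dm K m) : val (Dm_mul i x y) = malg_mul i (val x) (val y).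
Proof. by []. Qed.

Lemma Dm_mul_Dyck_axioms : Dyck_axioms (@Dm_mul K m).
Proof.
have [mul_bilin mul_lt mul_sum] := malg_mul_Dyck_axioms.
split=> [i | i j x y z ij | i x y z].
- split=> [y | x] a u v; apply: val_inj.
    by rewrite linearP; apply: (mul_bilin i).1.
  by rewrite linearP; apply: (mul_bilin i).2.
- by apply: val_inj; rewrite !val_Dm_mul mul_lt.
- by apply: val_inj; rewrite !linear_sum; apply: mul_sum.
Qed.

End TreeProducts.

(** * The universal property *)

Section UniversalProperty.
Variables (K : fieldType) (m : nat).
Implicit Types (i j k : 'I_m.+1) (t l r w : ctree m).

Fixpoint eval (B : Type) (op : 'I_m.+1 -> B -> B -> B) (b : B) t : B :=
  if t is Node i l r then op i (eval op b l) (eval op b r) else b.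

Lemma linext_eval_morphism (B : lmodType K) (op : 'I_m.+1 -> B -> B -> B) (b : B) :
  Dyck_axioms op -> Dyck_morphism (@malg_mul K m) op (linext (eval op b)).
Proof.
move=> op_Dyck; apply: node_morphism_tree_mul => // i l r.
by rewrite /= !linextU.
Qed.

Definition Dm_tree t (Bt : inB t) : Dm K m := MkDm (supp_inU K Bt).

Lemma Dm_linear_ext (B : lmodType K) (f g : {linear Dm K m -> B}) :
  (forall t (Bt : inB t), f (Dm_tree Bt) = g (Dm_tree Bt)) -> f =1 g.
Proof.
move=> fg x; pose d t : Dm K m := insubd 0 << t >>.
have -> : x = \sum_(t <- msupp (val x)) (val x)@_t *: d t.
  apply: val_inj; rewrite linear_sum -[LHS]linext_id.
  apply: eq_big_seq => t xt; rewrite linearZ /= val_insubd.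
  by rewrite supp_inU //; apply: (allP (valP x)).
rewrite !linear_sum; apply: eq_big_seq => t xt; rewrite !linearZ /=.
have Bt : inB t by apply: (allP (valP x)).
have -> : d t = Dm_tree Bt.
  by apply: val_inj; rewrite val_insubd supp_inU.
by rewrite fg.
Qed.

(** This is where the colour condition enters: a left subtree that is the leaf or
    has a larger root colour is multiplied by plain grafting. *)
Lemma Dm_tree_Node i l r (Bt : inB (Node i l r)) (Bl : inB l) (Br : inB r) :
  Dm_tree Bt = Dm_mul i (Dm_tree Bl) (Dm_tree Br).
Proof.
apply: val_inj; rewrite val_Dm_mul /= malg_mulUU.
by case/and3P: Bt; case: l Bl => [|j l1 l2] //= _ ->.
Qed.

Lemma Dm_free : free_Dyck_on_one (@Dm_mul K m) (Dm_leaf K m).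
Proof.
split=> [|B op op_Dyck b]; first exact: Dm_mul_Dyck_axioms.
pose f : {linear Dm K m -> B} := linext (eval op b) \o val.
have f_morph : Dyck_morphism (@Dm_mul K m) op f.
  by move=> i x y; apply: (linext_eval_morphism b op_Dyck i (val x) (val y)).
have f_leaf : f (Dm_leaf K m) = b by rewrite /= linextU.
exists f; split=> // g g_morph g_leaf; apply: Dm_linear_ext.
elim=> [|i l IHl r IHr] Bt.
  have -> : Dm_tree Bt = Dm_leaf K m by apply: val_inj.
  by rewrite g_leaf f_leaf.
have /and3P[_ Bl Br] := Bt.
by rewrite (Dm_tree_Node Bt Bl Br) g_morph f_morph IHl IHr.
Qed.

End UniversalProperty.

(** * Compatibility with the grading *)

Section Grading.
Variables (K : fieldType) (m : nat).

Lemma tree_mul_leaves (t w : ctree m) (i : 'I_m.+1) :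
  tree_mul K t i w \in supp_in (fun u => leaves u == (leaves t + leaves w)%N).
Proof.
elim: t i w => [|j l IHl r IHr] i w; first exact: supp_inU.
have graft_leaves (x y : {malg K[ctree m]}) a c :
    x \in supp_in (fun u => leaves u == a) ->
    y \in supp_in (fun u => leaves u == c) ->
  graft j x y \in supp_in (fun u => leaves u == (a + c)%N).
  move=> xa yc; apply: bilext_supp_in xa yc _ => t u /eqP ta /eqP uc.
  by apply: supp_inU; rewrite /= ta uc.
have tree_leaves t : << t >> \in @supp_in K m (fun u => leaves u == leaves t).
  exact: supp_inU.
have right_leaves k : graft j << l >> (tree_mul K r k w)
    \in supp_in (fun u => leaves u == (leaves l + leaves r + leaves w)%N).
  by rewrite -addnA; apply: graft_leaves.
rewrite /=; case: ltngtP => [ij | ji | /val_inj ij].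
- exact: supp_inU.
- exact: right_leaves.
rewrite ij; apply: rpredB; apply: rpred_sum => k _; first exact: right_leaves.
exact: graft_leaves.
Qed.

Lemma Dm_mul_homog (i : 'I_m.+1) (a c : nat) (x y : Dm K m) :
  x \in Dm_homog a -> y \in Dm_homog c -> Dm_mul i x y \in Dm_homog (a + c).
Proof.
move=> xa yc; apply: bilext_supp_in xa yc _ => t w /eqP <- /eqP <-.
exact: tree_mul_leaves.
Qed.

End Grading.

Theorem proposition1p2p7 (K : fieldType) (m : nat) (hm : (1 <= m)%N) :
  free_Dyck_on_one (@Dm_mul K m) (Dm_leaf K m) /\
  (Dm_leaf K m \in Dm_homog 1 /\
   forall (i : 'I_m.+1) (n r : nat) (x y : Dm K m),
     x \in Dm_homog n -> y \in Dm_homog r ->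
     Dm_mul i x y \in Dm_homog (n + r)).
Proof.
split; first exact: Dm_free.
by split=> [|i n r x y]; [exact: supp_inU | exact: Dm_mul_homog].
Qed.
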